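(* The ordinary generating function for nonnesting permutations that avoid $\{123,132,213\}$ is $$\sum_{n\ge0} c_n(123,132,213)\,x^n=\frac{1-x}{1-2x-2x^2+2x^3}.$$
   Context: A word $\pi=\pi_1\dots\pi_m$ over the positive integers contains the pattern $\sigma=\sigma_1\dots\sigma_k$ if there are indices $1\le i_1<\dots<i_k\le m$ such that for all $r,s\in\{1,\dots,k\}$: $\pi_{i_r}<\pi_{i_s}$ iff $\sigma_r<\sigma_s$, and $\pi_{i_r}=\pi_{i_s}$ iff $\sigma_r=\sigma_s$; otherwise $\pi$ avoids $\sigma$. $\mathcal{C}_n$ denotes the set of nonnesting permutations: arrangements (words) of the multiset $\{1,1,2,2,\dots,n,n\}$ that avoid the patterns $1221$ and $2112$ ($\mathcal{C}_0$ consists of the empty word only). For patterns $\sigma,\tau,\dots$, $c_n(\sigma,\tau,\dots)$ is the number of $\pi\in\mathcal{C}_n$ avoiding all of $\sigma,\tau,\dots$. The identity is one of formal power series in $x$. *)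

(* Defs.v *)
From HB Require Import structures.
From mathcomp Require Import all_boot all_order all_algebra.
From mathcomp Require Import boolp.

Set Implicit Arguments.
Unset Strict Implicit.
Unset Printing Implicit Defensive.
Set Warnings "-redundant-canonical-projection".

Import GRing.Theory.
Local Open Scope ring_scope.

(* The ring of formal power series R[[x]]: coefficient sequences with the
   Cauchy product.  Division is the [comUnitRingType] division, the units being
   the series whose constant term is a unit of R. *)

Record fps (R : Type) := Fps { fcoef : nat -> R }.

Section FpsRing.
Variable R : comNzRingType.
Implicit Types f g h : fps R.

Lemma fpsP f g : (forall n, fcoef f n = fcoef g n) <-> f = g.
Proof.
split=> [|-> //]; case: f => f; case: g => g /= fg; congr Fps.
exact/funext.
Qed.

HB.instance Definition _ := gen_eqMixin (fps R).
HB.instance Definition _ := gen_choiceMixin (fps R).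

Definition fps_zero : fps R := Fps (fun=> 0).
Definition fps_opp f : fps R := Fps (fun n => - fcoef f n).
Definition fps_add f g : fps R := Fps (fun n => fcoef f n + fcoef g n).

Fact fps_addA : associative fps_add.
Proof. by move=> f g h; apply/fpsP => n /=; rewrite addrA. Qed.
Fact fps_addC : commutative fps_add.
Proof. by move=> f g; apply/fpsP => n /=; rewrite addrC. Qed.
Fact fps_add0 : left_id fps_zero fps_add.
Proof. by move=> f; apply/fpsP => n /=; rewrite add0r. Qed.
Fact fps_addN : left_inverse fps_zero fps_opp fps_add.
Proof. by move=> f; apply/fpsP => n /=; rewrite addNr. Qed.

HB.instance Definition _ :=
  GRing.isZmodule.Build (fps R) fps_addA fps_addC fps_add0 fps_addN.

Definition fps_one : fps R := Fps (fun n => (n == 0%N)%:R).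
Definition fps_mul f g : fps R :=
  Fps (fun n => \sum_(i < n.+1) fcoef f i * fcoef g (n - i)).

Definition fps_trunc n f : {poly R} := \poly_(i < n.+1) fcoef f i.

Lemma coef_fps_trunc n f k : (k <= n)%N -> (fps_trunc n f)`_k = fcoef f k.
Proof. by move=> kn; rewrite coef_poly ltnS kn. Qed.

Lemma fcoef_mul_trunc n f g k : (k <= n)%N ->
  fcoef (fps_mul f g) k = (fps_trunc n f * fps_trunc n g)`_k.
Proof.
move=> kn; rewrite coefM; apply: eq_bigr => i _.
rewrite !coef_fps_trunc //; first exact: leq_trans (leq_subr _ _) kn.
by apply: leq_trans kn; rewrite -ltnS.
Qed.

Fact fps_mulA : associative fps_mul.
Proof.
move=> f g h; apply/fpsP => n.
transitivity ((fps_trunc n f * fps_trunc n g * fps_trunc n h)`_n).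
  rewrite -mulrA coefM /=; apply: eq_bigr => i _.
  rewrite -(@fcoef_mul_trunc n) ?leq_subr // coef_fps_trunc //.
  by rewrite -ltnS.
rewrite coefM /=; apply: eq_bigr => i _.
by rewrite -(@fcoef_mul_trunc n) ?coef_fps_trunc ?leq_subr // -ltnS.
Qed.

Fact fps_mulC : commutative fps_mul.
Proof.
by move=> f g; apply/fpsP => n; rewrite !(@fcoef_mul_trunc n) // mulrC.
Qed.

Fact fps_mul1 : left_id fps_one fps_mul.
Proof.
move=> f; apply/fpsP => n /=; rewrite big_ord_recl /= mul1r subn0.
by rewrite big1 ?addr0 // => i _; rewrite mul0r.
Qed.

Fact fps_mulDl : left_distributive fps_mul fps_add.
Proof.
move=> f g h; apply/fpsP => n /=; rewrite -big_split /=.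
by apply: eq_bigr => i _; rewrite mulrDl.
Qed.

Fact fps_oner_neq0 : fps_one != 0.
Proof.
apply/eqP => /fpsP /(_ 0%N) /= /eqP.
by rewrite oner_eq0.
Qed.

HB.instance Definition _ := GRing.Zmodule_isComNzRing.Build (fps R)
  fps_mulA fps_mulC fps_mul1 fps_mulDl fps_oner_neq0.

Definition fpsX : fps R := Fps (fun n => (n == 1%N)%:R).

End FpsRing.

Section FpsUnit.
Variable R : comUnitRingType.
Implicit Types f g : fps R.

Definition fps_unit : pred (fps R) :=
  fun f => fcoef f 0 \is a GRing.unit.

(* The coefficients g_n, ..., g_0 (in this order) of the inverse g of f, from
   g_0 = 1/f_0 and g_(n+1) = - (f_1 g_n + ... + f_(n+1) g_0) / f_0. *)
Fixpoint fps_inv_seq f n : seq R :=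
  if n is m.+1 then
    (- ((fcoef f 0)^-1 *
        \sum_(i < m.+1) fcoef f i.+1 * (fps_inv_seq f m)`_i))
      :: fps_inv_seq f m
  else [:: (fcoef f 0)^-1].

Definition fps_inv f : fps R :=
  if fps_unit f then Fps (fun n => (fps_inv_seq f n)`_0) else f.

Lemma fps_inv_seqE f n i : (i <= n)%N ->
  (fps_inv_seq f n)`_i = (fps_inv_seq f (n - i))`_0.
Proof.
elim: n i => [|n IHn] [|i] // le_in.
by rewrite subSS -IHn.
Qed.

Fact fps_mulV : {in fps_unit, left_inverse 1 fps_inv *%R}.
Proof.
move=> f f_in; have f_unit : fps_unit f := f_in.
rewrite mulrC /fps_inv f_unit; apply/fpsP => n.
case: n => [|n] /=; first by rewrite big_ord1 /= divrr.
rewrite big_ord_recl /= mulrN mulrA divrr // mul1r addrC.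
apply/eqP; rewrite subr_eq0; apply/eqP/eq_bigr => i _.
by rewrite subSS -fps_inv_seqE // -ltnS.
Qed.

Fact fps_unitPl : forall f g, g * f = 1 -> fps_unit f.
Proof.
move=> f g /fpsP /(_ 0%N) /=; rewrite big_ord1 /= => gf1.
by apply/unitrPr; exists (fcoef g 0); rewrite mulrC.
Qed.

Fact fps_inv_out : {in [predC fps_unit], fps_inv =1 id}.
Proof. by move=> f f_out; rewrite /fps_inv ifN. Qed.

HB.instance Definition _ := GRing.ComNzRing_hasMulInverse.Build (fps R)
  fps_mulV fps_unitPl fps_inv_out.

End FpsUnit.

Local Open Scope nat_scope.

(* The embedding f sends the (0-indexed) positions of the pattern p to those of
   the word w. *)
Definition contains (w p : seq nat) : bool :=
  [exists f : {ffun 'I_(size p) -> 'I_(size w)},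
    [forall r : 'I_(size p), forall s : 'I_(size p),
      [&& (r < s) ==> (f r < f s),
          (nth 0 w (f r) < nth 0 w (f s)) == (nth 0 p r < nth 0 p s)
        & (nth 0 w (f r) == nth 0 w (f s)) == (nth 0 p r == nth 0 p s)]]].

Definition avoids (w p : seq nat) : bool := ~~ contains w p.

Definition avoids_all (ps : seq (seq nat)) (w : seq nat) : bool :=
  all (avoids w) ps.

(* The word 1 1 2 2 ... n n. *)
Definition doubled (n : nat) : seq nat :=
  flatten [seq [:: i; i] | i <- iota 1 n].

(* [permutations] lists each distinct rearrangement exactly once. *)
Definition nonnesting (n : nat) : seq (seq nat) :=
  [seq w <- permutations (doubled n)
     | avoids_all [:: [:: 1; 2; 2; 1]; [:: 2; 1; 1; 2]] w].

Definition num_avoiding (ps : seq (seq nat)) (n : nat) : nat :=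
  count (avoids_all ps) (nonnesting n).

Definition nonnesting_gf (ps : seq (seq nat)) : fps rat :=
  Fps (fun n => (num_avoiding ps n)%:R%R).

(* Main.v *)
Require Import Defs.
From mathcomp Require Import all_boot all_order all_algebra.
From mathcomp Require Import zify ring lra.

Set Implicit Arguments.
Unset Strict Implicit.
Unset Printing Implicit Defensive.

Import GRing.Theory.
Local Open Scope nat_scope.

(** Call a word admissible if it avoids the two nesting patterns and the three
    patterns of length 3, and let n >= 2.  In an admissible arrangement w of
    1 1 2 2 ... n n, two distinct letters standing before the second n would
    form 123 or 213 with it, so some k <= 2 copies of a single letter a < n
    stand there besides the first n.  If k > 0, then a = n - 1, since otherwise
    n - 1 would occur only after the second n and a, n, n - 1 would form 132.
    The placements of these k copies that do not nest leave four shapes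
    ([admissible_prefix]):
      - n n r,
      - n (n-1) n r,
      - (n-1) (n-1) n n r,
      - (n-1) n (n-1) n r.

    The rest r is then admissible as well, and so is (n-1) r in the second
    shape, because admissibility passes to subsequences.

    Conversely, no forbidden pattern splits into a left part lying strictly
    above its right part.  Hence prefixing an admissible word by an admissible
    word on larger letters cannot create an occurrence
    ([admissible_skew_sum]), so an admissible r makes the first, third and
    fourth shapes admissible.  The second shape is not such a concatenation;
    it is admissible as soon as (n-1) r is ([admissible_overlap]).

    Let a_n count the admissible arrangements and b_n those starting with n.
    Then a_n = a_(n-1) + b_(n-1) + 2 a_(n-2) and b_n = a_(n-1) + b_(n-1), and
    eliminating b gives a_n + 2 a_(n-3) = 2 a_(n-1) + 2 a_(n-2) for n >= 3
    ([size_words_rec3]).  With a_0 = a_1 = 1 and a_2 = 4, this is the stated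
    fraction cleared of its denominator. *)

(** * Occurrences of a pattern as subsequences *)

(** A boolean over explicit index ranges, so that it evaluates on a sequence
    of known length with unknown entries. *)
Definition order_iso (s p : seq nat) : bool :=
  (size s == size p) &&
  all (fun r => all (fun t =>
         ((nth 0 s r < nth 0 s t) == (nth 0 p r < nth 0 p t)) &&
         ((nth 0 s r == nth 0 s t) == (nth 0 p r == nth 0 p t)))
       (iota 0 (size p))) (iota 0 (size p)).

(** A strictly increasing list of positions is the restriction of the list of
    all positions to its own members, hence a subsequence of that list. *)
Lemma increasing_subseq (w js : seq nat) :
  sorted ltn js -> all (gtn (size w)) js ->
  subseq [seq nth 0 w j | j <- js] w.
Proof.
move=> js_inc /allP js_lt.
rewrite -{2}(mkseq_nth 0 w); apply: map_subseq.
rewrite (_ : js = [seq j <- iota 0 (size w) | j \in js]) ?filter_subseq //.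
apply: (irr_sorted_eq ltn_trans ltnn) => // [|j].
  by rewrite (subseq_sorted ltn_trans (filter_subseq _ _)) ?iota_ltn_sorted.
rewrite mem_filter mem_iota andbC /= add0n.
by case: (boolP (j \in js)) => [/js_lt /= ->|]; rewrite ?andbF.
Qed.

Lemma subseq_increasing (s w : seq nat) : subseq s w ->
  exists2 js, sorted ltn js /\ all (gtn (size w)) js
            & s = [seq nth 0 w j | j <- js].
Proof.
case/subseqP=> m _ ->; exists (mask m (iota 0 (size w))).
  split; last first.
    by apply/allP => j /mem_mask; rewrite mem_iota.
  exact: (subseq_sorted ltn_trans (mask_subseq _ _) (iota_ltn_sorted _ _)).
by rewrite map_mask [map _ _](mkseq_nth 0 w).
Qed.

(** Trades embeddings of positions for subsequences, whose membership in a
    word built by [cons] and [++] can be analysed by computation. *)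
Lemma containsP (w p : seq nat) :
  reflect (exists2 s, subseq s w & order_iso s p) (contains w p).
Proof.
apply: (iffP existsP) => [[f /forallP f_occ]|[s /subseq_increasing[js]]].
  have {}f_occ (r t : 'I_(size p)) : [&& (r < t) ==> (f r < f t),
      (nth 0 w (f r) < nth 0 w (f t)) == (nth 0 p r < nth 0 p t)
    & (nth 0 w (f r) == nth 0 w (f t)) == (nth 0 p r == nth 0 p t)].
    exact: (forallP (f_occ r)).
  pose js := [seq val (f r) | r <- enum 'I_(size p)].
  have sz_js : size js = size p by rewrite size_map size_enum_ord.
  have nth_js (r : 'I_(size p)) : nth 0 js r = f r.
    by rewrite (nth_map r) ?size_enum_ord // nth_ord_enum.
  exists [seq nth 0 w j | j <- js].
    apply: increasing_subseq; last first.
      by apply/allP => _ /mapP[r _ ->] /=.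
    apply/(sortedP 0) => i; rewrite sz_js => i_lt.
    have /and3P[/implyP lt_f _ _] := f_occ (Ordinal (ltnW i_lt)) (Ordinal i_lt).
    by rewrite -!nth_js in lt_f; apply: lt_f => /=.
  rewrite /order_iso size_map sz_js eqxx /=.
  apply/allP => r; rewrite mem_iota add0n /= => r_lt.
  apply/allP => t; rewrite mem_iota add0n /= => t_lt.
  have /and3P[_] := f_occ (Ordinal r_lt) (Ordinal t_lt).
  by rewrite -!nth_js !(nth_map 0) ?sz_js //= => -> ->.
case=> js_inc /allP js_lt -> /andP[]; rewrite size_map => /eqP sz_js iso.
have lt_js (r : 'I_(size p)) : nth 0 js r < size w.
  by apply: js_lt; rewrite mem_nth ?sz_js.
exists [ffun r => Ordinal (lt_js r)].
apply/forallP => r; apply/forallP => t; rewrite !ffunE /=.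
have := allP (allP iso r _) t; rewrite !mem_iota !add0n /=.
rewrite !ltn_ord => /(_ isT isT); rewrite !(nth_map 0) ?sz_js // => ->.
rewrite andbT; apply/implyP => lt_rt.
by apply: (sorted_ltn_nth ltn_trans 0 js_inc); rewrite ?inE ?sz_js.
Qed.

Lemma order_iso_size (s p : seq nat) : order_iso s p -> size s = size p.
Proof. by case/andP=> /eqP. Qed.

Lemma order_iso_123 (a b c : nat) :
  order_iso [:: a; b; c] [:: 1; 2; 3] = (a < b < c).
Proof. by rewrite /order_iso /=; apply/idP/idP; lia. Qed.
Lemma order_iso_132 (a b c : nat) :
  order_iso [:: a; b; c] [:: 1; 3; 2] = (a < c < b).
Proof. by rewrite /order_iso /=; apply/idP/idP; lia. Qed.
Lemma order_iso_213 (a b c : nat) :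
  order_iso [:: a; b; c] [:: 2; 1; 3] = (b < a < c).
Proof. by rewrite /order_iso /=; apply/idP/idP; lia. Qed.
Lemma order_iso_1221 (a b c d : nat) :
  order_iso [:: a; b; c; d] [:: 1; 2; 2; 1] = [&& a < b, b == c & d == a].
Proof. by rewrite /order_iso /=; apply/idP/idP; lia. Qed.
Lemma order_iso_2112 (a b c d : nat) :
  order_iso [:: a; b; c; d] [:: 2; 1; 1; 2] = [&& b < a, b == c & d == a].
Proof. by rewrite /order_iso /=; apply/idP/idP; lia. Qed.

(** * Admissible words *)

Definition admissible (w : seq nat) : bool :=
  avoids_all [:: [:: 1; 2; 2; 1]; [:: 2; 1; 1; 2]] w &&
  avoids_all [:: [:: 1; 2; 3]; [:: 1; 3; 2]; [:: 2; 1; 3]] w.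

(** The five patterns collapse to three conditions: 123 and 213 together say
    that distinct letters are never followed by a letter above both, and 1221
    and 2112 together say that no pair of copies encloses another. *)
Lemma admissibleP (w : seq nat) :
  reflect [/\ forall a b c, subseq [:: a; b; c] w -> a < c -> b < c -> a = b,
              forall a b c, subseq [:: a; b; c] w -> a < c -> b <= c
            & forall a b, subseq [:: a; b; b; a] w -> a = b]
          (admissible w).
Proof.
rewrite /admissible /= !andbT -!andbA.
apply: (iffP and5P) => [[/containsP n1221 /containsP n2112 /containsP n123
    /containsP n132 /containsP n213]|[tops mids nest]].
  split=> [a b c abc ltac ltbc|a b c abc ltac|a b abba].
  - case: (ltngtP a b) => // [ltab|ltba].
      by case: n123; exists [:: a; b; c]; rewrite // order_iso_123 ltab.
    by case: n213; exists [:: a; b; c]; rewrite // order_iso_213 ltba.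
  - rewrite leqNgt; apply/negP => ltcb.
    by case: n132; exists [:: a; b; c]; rewrite // order_iso_132 ltac.
  case: (ltngtP a b) => // [ltab|ltba].
    by case: n1221; exists [:: a; b; b; a]; rewrite // order_iso_1221 ltab !eqxx.
  by case: n2112; exists [:: a; b; b; a]; rewrite // order_iso_2112 ltba !eqxx.
split; apply/containsP => -[s sw iso]; have := order_iso_size iso.
- case: s sw iso => [|a [|b [|c [|d []]]]] //= + + _; rewrite order_iso_1221.
  move=> sw /and3P[ltab /eqP ? /eqP ?]; subst.
  by have := nest _ _ sw; lia.
- case: s sw iso => [|a [|b [|c [|d []]]]] //= + + _; rewrite order_iso_2112.
  move=> sw /and3P[ltab /eqP ? /eqP ?]; subst.
  by have := nest _ _ sw; lia.
- case: s sw iso => [|a [|b [|c []]]] //= + + _; rewrite order_iso_123.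
  by move=> sw iso; have := tops _ _ _ sw; lia.
- case: s sw iso => [|a [|b [|c []]]] //= + + _; rewrite order_iso_132.
  by move=> sw iso; have := mids _ _ _ sw; lia.
case: s sw iso => [|a [|b [|c []]]] //= + + _; rewrite order_iso_213.
by move=> sw iso; have := tops _ _ _ sw; lia.
Qed.

Lemma admissible_subseq (u w : seq nat) :
  subseq u w -> admissible w -> admissible u.
Proof.
move=> uw /admissibleP[tops mids nest]; apply/admissibleP.
split=> [a b c s|a b c s|a b s].
- by apply: tops; apply: subseq_trans uw.
- by apply: mids; apply: subseq_trans uw.
- by apply: nest; apply: subseq_trans uw.
Qed.

Lemma subseq_catP (T : eqType) (s u v : seq T) :
  subseq s (u ++ v) ->
  exists s1 s2, [/\ s = s1 ++ s2, subseq s1 u & subseq s2 v].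
Proof.
case/subseqP=> m sz_m ->; exists (mask (take (size u) m) u).
exists (mask (drop (size u) m) v); rewrite !mask_subseq; split=> //.
rewrite -mask_cat ?cat_take_drop // size_takel //.
by rewrite sz_m size_cat leq_addr.
Qed.

(** * Prefixing by larger letters *)

Definition skew_indecomposable (p : seq nat) : bool :=
  all (fun i => ~~ allrel gtn (take i p) (drop i p)) (iota 1 (size p).-1).

Lemma order_iso_allrel (s1 s2 p : seq nat) :
  order_iso (s1 ++ s2) p -> allrel gtn s1 s2 ->
  allrel gtn (take (size s1) p) (drop (size s1) p).
Proof.
case/andP=> /eqP sz_p iso /allrelP gt_s.
have sz1 : size s1 <= size p by rewrite -sz_p size_cat leq_addr.
apply/allrelP => x y /(nthP 0)[r + <-] /(nthP 0)[t + <-].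
rewrite size_takel // size_drop => r_lt t_lt /=; rewrite nth_take // nth_drop.
have := allP (allP iso (size s1 + t) _) r; rewrite !mem_iota !add0n /=.
rewrite -sz_p size_cat ltn_add2l.
have t_lt2 : t < size s2 by rewrite -sz_p size_cat addKn in t_lt.
move=> /(_ t_lt2 (ltn_addr _ r_lt)) /andP[/eqP <- _].
rewrite !nth_cat r_lt [_ + _ < _]ltnNge leq_addr /= addKn.
by apply: gt_s; apply: mem_nth.
Qed.

(** An occurrence meeting both [u] and [v] would split the pattern into a part
    above and a part below. *)
Lemma avoids_skew_sum (u v p : seq nat) :
  skew_indecomposable p -> allrel gtn u v ->
  avoids u p -> avoids v p -> avoids (u ++ v) p.
Proof.
move=> /allP indec /allrelP gt_uv /containsP no_u /containsP no_v.
apply/containsP => -[_ /subseq_catP[s1 [s2 [-> su sv]]] iso].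
have sz_p := order_iso_size iso; rewrite size_cat in sz_p.
case: (posnP (size s1)) => [/size0nil s1_nil|s1_gt0].
  by case: no_v; exists s2; rewrite // s1_nil in iso.
case: (posnP (size s2)) => [/size0nil s2_nil|s2_gt0].
  by case: no_u; exists s1; rewrite // s2_nil cats0 in iso.
have split_in : size s1 \in iota 1 (size p).-1.
  rewrite mem_iota s1_gt0 -sz_p add1n prednK ?addn_gt0 ?s1_gt0 //.
  by rewrite -[ltnLHS]addn0 ltn_add2l.
have /negP[] := indec _ split_in.
apply: order_iso_allrel iso _; apply/allrelP => x y xs ys.
by apply: gt_uv; [apply: (mem_subseq su)|apply: (mem_subseq sv)].
Qed.

Lemma admissible_skew_sum (u v : seq nat) :
  allrel gtn u v -> admissible u -> admissible v -> admissible (u ++ v).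
Proof.
rewrite /admissible /avoids_all -!all_cat => gt_uv /allP au /allP av.
apply/allP => p p_in; apply: avoids_skew_sum (au p p_in) (av p p_in) => //.
by apply: (allP (_ : all skew_indecomposable _) p p_in).
Qed.

Lemma subseq_eq_size (T : eqType) (s w : seq T) :
  size s = size w -> subseq s w -> s = w.
Proof. by move=> sz /size_subseq_leqif[_]; rewrite sz eqxx => /esym/eqP. Qed.

Lemma admissible_double n : admissible [:: n; n].
Proof.
by apply/admissibleP; split=> [a b c|a b c|a b] /size_subseq.
Qed.

(** Two letters are too few for the patterns of length 3, and a pattern of
    length 4 would be the whole word. *)
Lemma admissible_concordant2 m (w : seq nat) :
  w \in [:: [:: m; m; m.+1; m.+1]; [:: m; m.+1; m; m.+1]] -> admissible w.
Proof.
rewrite !inE => w_cases.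
have w_sub : {subset w <= [:: m; m.+1]}.
  by case/orP: w_cases => /eqP -> x; rewrite !inE => /or4P[] ->; rewrite ?orbT.
apply/admissibleP; split=> [a b c /mem_subseq s|a b c /mem_subseq s|a b s].
- have := w_sub a (s a _); have := w_sub b (s b _); have := w_sub c (s c _).
  by rewrite !inE !eqxx ?orbT => /(_ isT) + /(_ isT) + /(_ isT); lia.
- have := w_sub a (s a _); have := w_sub b (s b _); have := w_sub c (s c _).
  by rewrite !inE !eqxx ?orbT => /(_ isT) + /(_ isT) + /(_ isT); lia.
have := subseq_eq_size _ s.
by case/orP: w_cases => /eqP -> /(_ erefl)[]; lia.
Qed.

(** An occurrence avoiding the maximal letter [m.+1] lives in [m :: w].  In one
    that uses it, the only smaller letter before its second copy is a single
    [m]: this excludes 123 and 213, which need two such letters, and 2112,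
    which needs two copies of [m] between those of [m.+1].  A 1221 would need a
    letter before the first [m.+1], and a 132 a letter strictly between [m] and
    [m.+1]. *)
Lemma admissible_overlap m (w : seq nat) :
  all (geq m) w -> admissible (m :: w) -> admissible [:: m.+1, m, m.+1 & w].
Proof.
move=> /allP w_le /admissibleP[tops mids nest].
(* In the cases below this refutes matching a copy of [m.+1] against [w]. *)
have top_notin (s : seq nat) : subseq s w -> m.+1 \notin s.
  by move=> /mem_subseq sw; apply/negP => /sw/w_le; rewrite /= ltnn.
have no_top (s : seq nat) : m.+1 \notin s ->
    subseq s [:: m.+1, m, m.+1 & w] -> subseq s (m :: w).
  move=> s_ntop s_sub.
  have : subseq s [seq x <- [:: m.+1, m, m.+1 & w] | x != m.+1].
    by rewrite subseq_filter s_sub andbT; apply/allP => x; apply: contraTneq => ->.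
  rewrite /= eqxx /= (ltn_eqF (ltnSn m)) /=.
  by rewrite (all_filterP _) //; apply/allP => x /w_le /=; lia.
have le_top s x : subseq s [:: m.+1, m, m.+1 & w] -> x \in s -> x <= m.+1.
  move=> /mem_subseq sw /sw.
  by rewrite !inE => /or4P[/eqP|/eqP|/eqP|/w_le /=]; lia.
apply/admissibleP; split=> [a b c s ltac ltbc|a b c s ltac|a b s].
- have c_le : c <= m.+1 by apply: le_top s _; rewrite !inE eqxx !orbT.
  case: (eqVneq c m.+1) => [c_top|c_ntop]; last first.
    by apply: (tops a b c (no_top _ _ s)) => //; rewrite !inE; lia.
  move: s; rewrite c_top in ltac ltbc *; rewrite /= (ltn_eqF ltac).
  case: eqP => _; first rewrite (ltn_eqF ltbc); last rewrite (ltn_eqF ltac).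
    by move/top_notin; rewrite !inE eqxx orbT.
  by move/top_notin; rewrite !inE eqxx !orbT.
- have b_le : b <= m.+1 by apply: le_top s _; rewrite !inE eqxx !orbT.
  have c_le : c <= m.+1 by apply: le_top s _; rewrite !inE eqxx !orbT.
  case: (eqVneq c m.+1) => [-> //|c_ntop].
  case: (eqVneq b m.+1) => [b_top|b_ntop]; last first.
    by apply: (mids a b c (no_top _ _ s)) => //; rewrite !inE; lia.
  have a_lt : a < m.+1 by rewrite (leq_trans ltac).
  move: s; rewrite b_top /= (ltn_eqF a_lt); case: eqP => [a_m|_].
    by rewrite eqxx sub1seq => /w_le /=; lia.
  by rewrite (ltn_eqF a_lt) => /top_notin; rewrite !inE eqxx orbT.
case: (eqVneq a b) => // ab.
case: (eqVneq a m.+1) => [a_top|a_ntop].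
  have b_ntop : (b == m.+1) = false by rewrite -a_top eq_sym; apply: negPf.
  move: s; rewrite a_top /= eqxx.
  case: eqP => _; rewrite b_ntop; by move/top_notin; rewrite !inE eqxx !orbT.
case: (eqVneq b m.+1) => [b_top|b_ntop]; last first.
  by apply: (nest a b (no_top _ _ s)); rewrite !inE; lia.
move: s; rewrite b_top /= (negPf a_ntop).
case: eqP => _; first rewrite eqxx; last rewrite (negPf a_ntop).
  by move/top_notin; rewrite !inE eqxx.
by move/top_notin; rewrite !inE eqxx orbT.
Qed.

(** * The shape of an admissible arrangement *)

Lemma doubledS n : doubled n.+1 = doubled n ++ [:: n.+1; n.+1].
Proof. by rewrite /doubled -(addn1 n) iotaD map_cat flatten_cat addnC. Qed.

Lemma count_doubled x n : count_mem x (doubled n) = (0 < x <= n).*2.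
Proof.
elim: n => [|n IHn]; first by case: x.
by rewrite doubledS count_cat IHn /=; case: ltngtP; lia.
Qed.

Lemma mem_doubled x n : (x \in doubled n) = (0 < x <= n).
Proof. by rewrite -has_pred1 has_count count_doubled double_gt0 lt0b. Qed.

Lemma count2_split (T : eqType) (x : T) (w : seq T) :
  count_mem x w = 2 ->
  exists p q r, w = p ++ x :: q ++ x :: r /\ x \notin p ++ q ++ r.
Proof.
move=> w2; have x_w : x \in w by rewrite -has_pred1 has_count w2.
case/splitPr: x_w w2 => p t; rewrite count_cat /= eqxx.
case: (boolP (x \in p)) => [/splitPr[p1 p2]|p_x] t2.
  rewrite count_cat /= eqxx in t2.
  exists p1, p2, t; rewrite -catA; split=> //.
  by rewrite -has_pred1 has_count !count_cat; lia.
have x_t : x \in t.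
  by rewrite -has_pred1 has_count; move/count_memPn: p_x t2 => ->; lia.
case/splitPr: x_t t2 => q r; rewrite count_cat /= eqxx => t2.
exists p, q, r; split=> //.
by rewrite -has_pred1 has_count !count_cat; lia.
Qed.

(** The letters [p ++ q] standing before the second copy of the maximum, other
    than its first copy, are all equal; by 132 they are copies of [m], and only
    non-nesting placements of them survive. *)
Lemma admissible_prefix m (w : seq nat) :
  perm_eq w (doubled m.+1) -> admissible w ->
  exists r, w = [:: m.+1, m.+1 & r] \/
    0 < m /\ [\/ w = [:: m.+1, m, m.+1 & r], w = [:: m, m, m.+1, m.+1 & r]
               | w = [:: m, m.+1, m, m.+1 & r]].
Proof.
move=> w_doubled /admissibleP[tops mids nest].
have w_count x : count_mem x w = (0 < x <= m.+1).*2.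
  by rewrite -count_doubled; apply/permP.
have w_mem x : (x \in w) = (0 < x <= m.+1).
  by rewrite (perm_mem w_doubled) mem_doubled.
have [p [q [r [def_w no_top]]]] : exists p q r,
    w = p ++ m.+1 :: q ++ m.+1 :: r /\ m.+1 \notin p ++ q ++ r.
  by apply: count2_split; rewrite w_count ltnSn.
exists r; move: no_top; rewrite catA mem_cat negb_or => /andP[pq_top r_top].
have pq_w : subseq ((p ++ q) ++ [:: m.+1]) w.
  rewrite def_w -catA cat_subseq //; apply: subseq_trans (subseq_cons _ _).
  by rewrite cat_subseq // sub1seq inE eqxx.
have pq_lt x : x \in p ++ q -> 0 < x < m.+1.
  move=> x_pq; have : x \in w by apply: (mem_subseq pq_w); rewrite mem_cat x_pq.
  rewrite w_mem (ltn_neqAle x) => /andP[-> ->]; rewrite andbT.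
  by apply: contraNneq pq_top => <-.
case def_pq: (p ++ q) => [|a s].
  by left; case: p q def_pq def_w {pq_w pq_lt pq_top} => [|//] [|//] _ ->.
right; have a_lt : 0 < a < m.+1 by apply: pq_lt; rewrite def_pq inE eqxx.
(* Distinct letters before the second maximum would give 123 or 213. *)
have s_a : s = nseq (size s) a.
  apply/all_pred1P/allP => y y_s /=; apply/eqP/esym.
  have /pq_lt/andP[_ y_lt] : y \in p ++ q by rewrite def_pq inE y_s orbT.
  apply: (tops a y m.+1) => //; last by case/andP: a_lt.
  apply: subseq_trans pq_w; rewrite def_pq /= eqxx.
  by apply: (@cat_subseq _ [:: y] [:: m.+1]); rewrite sub1seq ?inE.
have a_w : a \in w by rewrite w_mem; lia.
(* If [a < m], both copies of [m] come last: [a], [m.+1], [m] form 132. *)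
have def_a : a = m.
  apply/eqP; rewrite eqn_leq -ltnS; case/andP: a_lt => a_gt0 -> /=.
  rewrite leqNgt; apply/negP => a_ltm.
  have m_r : m \in r.
    have : m \in w by rewrite w_mem; lia.
    have : m \notin p ++ q by rewrite def_pq s_a inE mem_nseq; lia.
    rewrite mem_cat negb_or def_w => /andP[m_p m_q].
    by rewrite !(mem_cat, inE) (negPf m_p) (negPf m_q) ltn_eqF.
  have /mids/(_ a_ltm) : subseq [:: a; m.+1; m] w; last by rewrite ltnn.
  have -> : w = (p ++ m.+1 :: q) ++ m.+1 :: r by rewrite def_w -catA.
  apply: (@cat_subseq _ [:: a] [:: m.+1; m]); last by rewrite /= eqxx sub1seq.
  rewrite sub1seq mem_cat inE.
  by have := mem_head a s; rewrite -def_pq mem_cat => /orP[] ->; rewrite ?orbT.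
have s_le1 : size s <= 1.
  have pq_a : count_mem a (p ++ q) = (size s).+1.
    by rewrite def_pq s_a /= eqxx count_nseq /= eqxx mul1n size_nseq.
  have w_a : count_mem a w <= 2 by rewrite w_count; case: (0 < _ <= _).
  rewrite -ltnS -pq_a; apply: leq_trans w_a.
  by rewrite def_w !count_cat /= !count_cat /=; lia.
split; first by lia.
rewrite {}def_a in s_a def_pq a_lt a_w.
case: s s_a s_le1 def_pq => [|b [|//]] => [_ _|[->] _] def_pq.
  case: p def_pq def_w {pq_w pq_lt pq_top} => [|x p] /=.
    by move=> -> ->; constructor.
  (* [m, m.+1, m.+1, r]: the other [m] lies in [r], so a nesting occurs. *)
  case=> -> /eqP; rewrite -size_eq0 size_cat addn_eq0 !size_eq0.
  case/andP=> /eqP-> /eqP-> def_w.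
  have m_r : m \in r.
    rewrite -has_pred1 has_count; move: (w_count m); rewrite def_w /= eqxx leqnSn.
    by rewrite (gtn_eqF (ltnSn m)); case: (0 < m) a_lt => //=; lia.
  have /nest/eqP : subseq [:: m; m.+1; m.+1; m] w.
    by rewrite def_w /= !eqxx sub1seq.
  by rewrite ltn_eqF.
case: p def_pq def_w {pq_w pq_lt pq_top} => [|x [|y p]] /=.
- move=> -> def_w; have /nest/eqP : subseq [:: m.+1; m; m; m.+1] w.
    by rewrite def_w /= !eqxx sub0seq.
  by rewrite gtn_eqF.
- by case=> -> -> ->; constructor.
case=> -> -> /eqP; rewrite -size_eq0 size_cat addn_eq0 !size_eq0.
by move=> /andP[/eqP-> /eqP->] ->; constructor.
Qed.

(** * The recurrence *)

Definition words (n : nat) : seq (seq nat) :=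
  [seq w <- permutations (doubled n) | admissible w].

Lemma mem_words n w : (w \in words n) = admissible w && perm_eq w (doubled n).
Proof. by rewrite mem_filter mem_permutations. Qed.

Lemma num_avoiding_words n :
  num_avoiding [:: [:: 1; 2; 3]; [:: 1; 3; 2]; [:: 2; 1; 3]] n = size (words n).
Proof.
rewrite /num_avoiding /nonnesting count_filter -size_filter.
by congr size; apply: eq_filter => w; rewrite /= andbC.
Qed.

Lemma words_le n w x : w \in words n -> x \in w -> x <= n.
Proof.
rewrite mem_words => /andP[_ /perm_mem w_mem]; rewrite w_mem mem_doubled.
by case/andP.
Qed.

(** In the second family the leading [m.+1] of a shorter word is moved between
    the two copies of [m.+2], which accounts for [behead]. *)
Definition prefixed_words m : seq (seq nat) :=
  [seq [:: m.+2; m.+2] ++ w | w <- words m.+1] ++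
  [seq [:: m.+2, m.+1, m.+2 & behead w] | w <- words m.+1 & head 0 w == m.+1] ++
  [seq [:: m.+1; m.+1; m.+2; m.+2] ++ w | w <- words m] ++
  [seq [:: m.+1; m.+2; m.+1; m.+2] ++ w | w <- words m].

Lemma perm_double_cons m (w : seq nat) :
  perm_eq ([:: m.+1; m.+1] ++ w) (doubled m.+1) = perm_eq w (doubled m).
Proof. by rewrite doubledS perm_catC perm_cat2r. Qed.

Lemma perm_double2_cons m (u w : seq nat) :
  perm_eq u [:: m.+2; m.+2; m.+1; m.+1] ->
  perm_eq (u ++ w) (doubled m.+2) = perm_eq w (doubled m).
Proof.
move=> u_perm; rewrite -[RHS]perm_double_cons -[RHS]perm_double_cons catA.
by apply: permPl; rewrite perm_cat2r.
Qed.

Lemma mem_prefixed_words m : words m.+2 =i prefixed_words m.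
Proof.
have perm_mmnn :
    perm_eq [:: m.+1; m.+1; m.+2; m.+2] [:: m.+2; m.+2; m.+1; m.+1].
  by rewrite (perm_catC [:: m.+1; m.+1]).
have perm_mnmn :
    perm_eq [:: m.+1; m.+2; m.+1; m.+2] [:: m.+2; m.+2; m.+1; m.+1].
  by apply/permP => P /=; case: (P m.+1); case: (P m.+2).
have perm_nmn (w : seq nat) :
    perm_eq [:: m.+2, m.+1, m.+2 & w] (doubled m.+2)
    = perm_eq (m.+1 :: w) (doubled m.+1).
  rewrite -[RHS]perm_double_cons; apply: permPl; apply/permP => P /=.
  by case: (P m.+1); case: (P m.+2).
move=> w; rewrite mem_words !mem_cat; apply/idP/idP.
  case/andP=> w_adm w_perm.
  have [r [def_w|[_ [def_w|def_w|def_w]]]] := admissible_prefix w_perm w_adm.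
  - apply/or4P/Or41/mapP; exists r => //; rewrite mem_words.
    rewrite -perm_double_cons /= -def_w w_perm andbT.
    apply: admissible_subseq w_adm; rewrite def_w.
    exact: (suffix_subseq [:: _; _]).
  - apply/or4P/Or42/mapP; exists (m.+1 :: r) => //.
    rewrite mem_filter eqxx mem_words -perm_nmn -def_w w_perm andbT.
    apply: admissible_subseq w_adm; rewrite def_w.
    apply: subseq_trans (subseq_cons _ _).
    by apply: (@cat_subseq _ [:: m.+1] r [:: m.+1]) (subseq_cons _ _).
  - apply/or4P/Or43/mapP; exists r => //; rewrite mem_words.
    rewrite -(perm_double2_cons _ perm_mmnn) /= -def_w w_perm andbT.
    apply: admissible_subseq w_adm; rewrite def_w.
    exact: (suffix_subseq [:: _; _; _; _]).
  apply/or4P/Or44/mapP; exists r => //; rewrite mem_words.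
  rewrite -(perm_double2_cons _ perm_mnmn) /= -def_w w_perm andbT.
  apply: admissible_subseq w_adm; rewrite def_w.
  exact: (suffix_subseq [:: _; _; _; _]).
case/or4P=> /mapP[r r_in ->].
- rewrite perm_double_cons; move: (r_in); rewrite mem_words => /andP[r_adm ->].
  rewrite andbT admissible_skew_sum ?admissible_double //.
  by apply/allrelP => x y; rewrite !inE orbb => /eqP-> /(words_le r_in).
- move: r_in; rewrite mem_filter => /andP[r_head r_in].
  case: r r_head r_in => [|x r] //= /eqP-> r_in.
  rewrite perm_nmn; move: (r_in); rewrite mem_words => /andP[r_adm ->].
  rewrite andbT admissible_overlap //; apply/allP => y y_r.
  by apply: (words_le r_in); rewrite inE y_r orbT.
- rewrite perm_double2_cons //; move: (r_in); rewrite mem_words => /andP[r_adm ->].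
  rewrite andbT; apply: admissible_skew_sum r_adm; last first.
    by apply: (@admissible_concordant2 m.+1); rewrite !inE eqxx.
  by apply/allrelP => x y; rewrite !inE => x_in /(words_le r_in) /=; lia.
rewrite perm_double2_cons //; move: (r_in); rewrite mem_words => /andP[r_adm ->].
rewrite andbT; apply: admissible_skew_sum r_adm; last first.
  by apply: (@admissible_concordant2 m.+1); rewrite !inE eqxx orbT.
by apply/allrelP => x y; rewrite !inE => x_in /(words_le r_in) /=; lia.
Qed.

Lemma words_uniq n : uniq (words n).
Proof. by rewrite filter_uniq ?permutations_uniq. Qed.

Lemma perm_words_rec m : perm_eq (words m.+2) (prefixed_words m).
Proof.
apply: uniq_perm (mem_prefixed_words m); first exact: words_uniq.
rewrite !cat_uniq !map_inj_in_uniq ?filter_uniq ?permutations_uniq //=; first last.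
- by move=> u v _ _ [].
- case=> [|x u] [|y v]; rewrite ?mem_filter //= => /andP[/eqP-> _] /andP[/eqP-> _].
  by case=> ->.
- by move=> u v _ _ [].
- by move=> u v _ _ [].
rewrite !andbT; apply/and3P; split; apply/hasPn => w.
- rewrite !mem_cat => /or3P[] /mapP[u _ ->]; apply/mapP => -[v _ [+ _]]; lia.
- rewrite mem_cat => /orP[] /mapP[u _ ->]; apply/mapP => -[v _ [+ _]]; lia.
by move=> /mapP[u _ ->]; apply/mapP => -[v _ [+ _]]; lia.
Qed.

(** Kept as a second sequence because the second family of [prefixed_words]
    consumes only the words that start with their maximum. *)
Definition top_first n : nat := count (fun w => head 0 w == n) (words n).

Lemma size_words_rec m :
  size (words m.+2) = size (words m.+1) + top_first m.+1 + (size (words m)).*2.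
Proof.
rewrite (perm_size (perm_words_rec m)) !size_cat !size_map size_filter.
by rewrite addnn addnA.
Qed.

Lemma top_first_rec m : top_first m.+2 = size (words m.+1) + top_first m.+1.
Proof.
have count_head x (f : seq nat -> seq nat) s : (forall w, head 0 (f w) = x) ->
    count (fun w => head 0 w == m.+2) (map f s) = (x == m.+2) * size s.
  move=> f_head; rewrite count_map (eq_count (a2 := fun=> x == m.+2)).
    by case: eqP => _; rewrite ?count_predT ?count_pred0 ?mul1n.
  by move=> w /=; rewrite f_head.
rewrite /top_first (permP (perm_words_rec m)) !count_cat.
rewrite (count_head m.+2) // (count_head m.+2) // (count_head m.+1) //.
rewrite (count_head m.+1) // eqxx !mul1n.
by rewrite (ltn_eqF (ltnSn _)) !mul0n !addn0 size_filter.
Qed.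

(** Comparing the two recurrences, [top_first m.+2] is the size of
    [words m.+2] minus twice that of [words m], which eliminates [top_first]. *)
Lemma size_words_rec3 m :
  size (words m.+3) + (size (words m)).*2
  = (size (words m.+2)).*2 + (size (words m.+1)).*2.
Proof.
by have := size_words_rec m.+1; have := size_words_rec m;
   rewrite top_first_rec; lia.
Qed.

Lemma words0 : words 0 = [:: [::]].
Proof.
apply: perm_small_eq => //; apply: uniq_perm; rewrite ?words_uniq // => w.
rewrite mem_words inE; apply/andP/eqP => [[_ /perm_nilP]|->] //.
by split=> //; apply/admissibleP; split=> [a b c|a b c|a b] /size_subseq.
Qed.

Lemma words1 : words 1 = [:: [:: 1; 1]].
Proof.
apply: perm_small_eq => //; apply: uniq_perm; rewrite ?words_uniq // => w.
rewrite mem_words inE; apply/andP/eqP => [[w_adm w_perm]|->]; last first.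
  by rewrite admissible_double.
have [r [def_w|[//]]] := admissible_prefix w_perm w_adm.
move: (perm_size w_perm); rewrite def_w /= => -[/size0nil->].
by [].
Qed.

(** * Coefficients of power series *)

Local Open Scope ring_scope.

Lemma fcoefD (R : comNzRingType) (f g : fps R) n :
  fcoef (f + g) n = fcoef f n + fcoef g n.
Proof. by []. Qed.

Lemma fcoefN (R : comNzRingType) (f : fps R) n : fcoef (- f) n = - fcoef f n.
Proof. by []. Qed.

Lemma fcoefMn (R : comNzRingType) (f : fps R) k n :
  fcoef (f *+ k) n = fcoef f n *+ k.
Proof. by elim: k => [|k IHk] //; rewrite !mulrS fcoefD IHk. Qed.

Lemma fcoefXM (R : comNzRingType) (f : fps R) n :
  fcoef (fpsX R * f) n = if n is m.+1 then fcoef f m else 0.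
Proof.
case: n => [|n] /=; first by rewrite big_ord1 mul0r.
rewrite 2!big_ord_recl /= mul0r add0r mul1r subSS subn0 big1 ?addr0 // => i _.
by rewrite mul0r.
Qed.

Theorem theorem2p11 :
  nonnesting_gf [:: [:: 1; 2; 3]; [:: 1; 3; 2]; [:: 2; 1; 3]]%N
  = (1 - fpsX rat) / (1 - 2 * fpsX rat - 2 * fpsX rat ^+ 2 + 2 * fpsX rat ^+ 3).
Proof.
set G := nonnesting_gf _; set X := fpsX rat.
have G_coef n : fcoef G n = (size (words n))%:R by rewrite /= num_avoiding_words.
set D := (X in _ = _ / X).
have XM n f : fcoef (X * f) n = if n is m.+1 then fcoef f m else 0 := fcoefXM f n.
have D_unit : D \is a GRing.unit.
  rewrite unfold_in /= /fps_unit /D !exprS expr0 mulr1 !mulr_natl.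
  by rewrite !(fcoefD, fcoefN, fcoefMn, XM).
apply: (canRL (mulrK D_unit)).
(* Multiplication by [X] is now a shift of the coefficients. *)
have -> : G * D = G - (X * G) *+ 2 - (X * (X * G)) *+ 2
                  + (X * (X * (X * G))) *+ 2.
  by rewrite /D; ring.
apply/fpsP => -[|[|[|n]]]; rewrite !(fcoefD, fcoefN, fcoefMn, XM, G_coef).
- by rewrite words0.
- by rewrite words0 words1.
- by rewrite size_words_rec /top_first words0 words1.
have := congr1 (fun k => k%:R : rat) (size_words_rec3 n).
rewrite -!muln2 !natrD !natrM.
by rewrite /=; lra.
Qed.
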